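(* Suppose that $X_1,\dots,X_n$ are max-independent real random variables with distribution functions $F_1,\dots,F_n$ satisfying $F_i(x)>0$ for all $x\in\mathbb{R}$ and $P(X_i=0)=0$ for $1\le i\le n$, and with a given generator $\eta(x_1,\dots,x_n)$. Define $$Y_1=\max(a_1X_1,\dots,a_nX_n)\quad\text{and}\quad Y_2=\max(b_1X_1,\dots,b_nX_n),$$ where $a_i>0$, $b_i>0$ for $1\le i\le n$ are given constants with $a_i/b_i\neq a_j/b_j$ for $1\le i\neq j\le n$. Then the joint distribution of $(Y_1,Y_2)$ uniquely determines the distribution functions of $X_i$, $1\le i\le n$. That is, if $X_1^*,\dots,X_n^*$ are max-independent real random variables with the same generator $\eta$ and with distribution functions $F_1^*,\dots,F_n^*$ satisfying $F_i^*(x)>0$ for all $x\in\mathbb{R}$ and $P(X_i^*=0)=0$ for $1\le i\le n$, and if $(\max_i a_iX_i^*,\max_i b_iX_i^* )$ has the same joint distribution as $(Y_1,Y_2)$, then $F_i^*=F_i$ for $1\le i\le n$.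
   Context: A finite collection of real random variables $X_1,\dots,X_n$ with joint distribution function $F(x_1,\dots,x_n)=P(X_1\le x_1,\dots,X_n\le x_n)$ and marginal distribution functions $F_i(x)=P(X_i\le x)$ is called max-independent if there exists a function $\eta:\mathbb{R}^n\to(0,1]$ such that $$F(x_1,\dots,x_n)=F_1(x_1)\cdots F_n(x_n)\,\eta(x_1,\dots,x_n)\quad\text{for all } x_1,\dots,x_n\in\mathbb{R},$$ and $\eta(x_1,\dots,x_n)\to 1$ if $x_i\to\infty$ for some $i$ (that is, for each $i$, as $x_i\to\infty$ with the other coordinates fixed). The function $\eta$ is called a generator of $(X_1,\dots,X_n)$. *)

(* Defs.v *)
From HB Require Import structures.
From mathcomp Require Import all_boot all_order all_algebra.
From mathcomp Require Import all_classical all_reals all_analysis.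
Set Implicit Arguments.
Unset Strict Implicit.
Unset Printing Implicit Defensive.
Import Order.TTheory GRing.Theory Num.Theory.
Import numFieldNormedType.Exports.
Local Open Scope classical_set_scope.
Local Open Scope ring_scope.

Section max_independence.
Context d (T : measurableType d) (R : realType) (P : probability T R).

Definition joint_cdf n (X : 'I_n -> {RV P >-> R}) (x : 'I_n -> R) : \bar R :=
  P [set w | forall i, X i w <= x i].

(* In the limit clause the [i]-th coordinate tends to +oo while the other
   coordinates are kept fixed. *)
Definition max_independent_with n (X : 'I_n -> {RV P >-> R})
    (eta : ('I_n -> R) -> R) : Prop :=
  [/\ forall x, 0 < eta x <= 1,
      forall x, joint_cdf X x = ((\prod_(i < n) cdf (X i) (x i)) * (eta x)%:E)%E
    & forall (i : 'I_n) x,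
        eta (fun j => if j == i then t else x j) @[t --> +oo] --> (1 : R)].

(* The maximum of the n+1 values [c i * X i w]; the initial value of the
   iteration is the first of them, so it does not affect the result. *)
Definition max_comb n (c : 'I_n.+1 -> R) (X : 'I_n.+1 -> {RV P >-> R})
    (w : T) : R :=
  \big[Num.max/c ord0 * X ord0 w]_(i < n.+1) (c i * X i w).

End max_independence.

Definition same_joint_distribution (R : realType)
    d (T : measurableType d) (P : probability T R) (Y1 Y2 : T -> R)
    d' (T' : measurableType d') (P' : probability T' R) (Z1 Z2 : T' -> R) :=
  forall A : set (R * R), measurable A ->
    pushforward P (fun w => (Y1 w, Y2 w)) A =
    pushforward P' (fun w => (Z1 w, Z2 w)) A.

(* Main.v *)
Require Import Defs.
From mathcomp Require Import all_boot all_order all_algebra.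
From mathcomp Require Import all_classical all_reals all_analysis.
From mathcomp Require Import ring lra.
Set Implicit Arguments.
Unset Strict Implicit.
Unset Printing Implicit Defensive.
Import Order.TTheory GRing.Theory Num.Theory.
Import numFieldNormedType.Exports.
Local Open Scope classical_set_scope.
Local Open Scope ring_scope.

(** The event [Y1 <= s, Y2 <= t] says that every [X i] is at most
    [min (s / a i) (t / b i)].  By max-independence its probability is the
    product of the [F_i (min (s / a i) (t / b i))] times a value of the
    generator, which is positive and the same for both families; so it cancels.
    With [phi_i = ln F_i - ln F*_i], equality of the two joint laws becomes
      [\sum_i phi_i (min (s / a i) (t / b i)) = 0]  for all real [s], [t],
    and the theorem reduces to showing that this equation forces [phi_i = 0]
    ([min_sum_eq0]).

    For [s, t > 0] the [i]-th minimum is [s / a i] exactly when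
    [s / t <= a i / b i].  As long as [s / t] stays between two consecutive
    ratios, the equation says that a function of [s] alone, the sum of
    [phi_i (s / a i)] over the larger ratios, is the opposite of a function of
    [t] alone.  Moving [s] and [t] independently inside this cone shows that
    the function of [s] is invariant under some scaling [s |-> q s], [q > 1];
    as all the [phi_i] tend to 0 at infinity, it vanishes.  The ratios being
    distinct, the sums over [a i / b i >= c], for all thresholds [c], determine
    each [phi_i], from the largest ratio downwards ([threshold_sum_eq0]).
    This proves [phi_i = 0] on the positive half-line, hence also at 0 by right
    continuity.

    The negative half-line is the same problem after the change of variable
    [s |-> - 1 / s], which exchanges the roles of [a] and [b] in the ratios and
    turns the limit at infinity into the left limit at 0.  That limit is
    [phi_i 0], that is 0, because [F_i] and [F*_i] have no jump at 0: this is where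
    [P (X_i = 0) = 0] is used ([cdf_left_cvg0]). *)

Lemma cvg_mul_exprn_pinfty (R : realType) (s q : R) :
  0 < s -> 1 < q -> s * q ^+ m @[m --> \oo] --> +oo.
Proof.
move=> s0 q1; have q0 : 0 < q by lra.
apply/gtr0_cvgV0; first by near=> m; rewrite mulr_gt0 ?exprn_gt0.
have -> : unstable.inv_fun (fun m => s * q ^+ m) = geometric s^-1 q^-1.
  by apply/funext => m; rewrite /geometric /= invfM exprVn.
apply: cvg_geometric; rewrite gtr0_norm ?invr_gt0//.
by rewrite invf_lt1.
Unshelve. all: by end_near. Qed.

(** Invariance propagates the value at [s] along [s * q ^+ m], a sequence that
    goes to infinity, where the function is small. *)
Lemma scale_invariant_eq0 (R : realType) (A : R -> R) (q : R) : 1 < q ->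
  A s @[s --> +oo] --> 0 -> (forall s, 0 < s -> A (s * q) = A s) ->
  forall s, 0 < s -> A s = 0.
Proof.
move=> q1 A0 Aq s s0; have q0 : 0 < q by lra.
have Am m : A (s * q ^+ m) = A s.
  elim: m => [|m IH]; first by rewrite expr0 mulr1.
  by rewrite exprSr mulrA Aq ?mulr_gt0 ?exprn_gt0.
have := cvg_comp _ _ (cvg_mul_exprn_pinfty s0 q1) A0.
rewrite (_ : A \o _ = fun=> A s); last exact/funext.
move=> h; exact: (cvg_unique _ (cvg_cst (A s)) h).
Qed.

(** A threshold [c] can be lowered to [c'] without changing which of the [r i]
    lie above it. *)
Lemma exists_gap_below (R : realFieldType) (I : finType) (r : I -> R) (c : R) :
  0 < c -> exists2 c', 0 < c' < c & forall i, c' <= r i -> c <= r i.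
Proof.
move=> c0; pose m := \big[Num.max/0]_(i | r i < c) r i.
have mc : m < c by apply/bigmax_ltP.
have [m0 mr] : 0 <= m /\ forall i, r i < c -> r i <= m by apply/bigmax_leP.
exists ((m + c) / 2); first by apply/andP; split; lra.
move=> i hi; rewrite leNgt; apply/negP => /mr; lra.
Qed.

(** The common core of the positive and the negative half-lines.  When [s / t]
    varies in a gap of the ratios [r i], the set of indices that contribute an
    [f i s] is fixed, so the variables separate and the tail sum
    [\sum_(i | c <= r i) f i s] is invariant under a scaling. *)
Lemma threshold_sum_eq0 (R : realType) (I : finType) (r : I -> R)
    (f g : I -> R -> R) :
  injective r -> (forall i, 0 < r i) ->
  (forall i, f i s @[s --> +oo] --> 0) ->
  (forall s t, 0 < s -> 0 < t ->
    \sum_i (if s <= r i * t then f i s else g i t) = 0) ->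
  forall i s, 0 < s -> f i s = 0.
Proof.
move=> rI r0 f0 fg.
have tail0 c : 0 < c -> forall s, 0 < s -> \sum_(i | c <= r i) f i s = 0.
  move=> c0; have [c' /andP[c'0 c'c] gap] := exists_gap_below r c0.
  (* The scaling factor is the width of the gap: [s] and [s * (c / c')] are the
     two ends of the range allowed for the same [t = s / c']. *)
  apply: (@scale_invariant_eq0 _ _ (c / c')).
  - by rewrite ltr_pdivlMr// mul1r.
  - rewrite -[X in _ --> X](big1 (idx := 0) (op := +%R) (index_enum I)
      (fun i => c <= r i) (fun=> 0))//.
    by apply: cvg_big => [|i _]; [exact: add_continuous|exact: f0].
  move=> s s0; pose t := s / c'.
  have t0 : 0 < t by rewrite divr_gt0.
  have cone u : c' * t <= u <= c * t ->
      \sum_(i | c <= r i) f i u = - \sum_(i | ~~ (c <= r i)) g i t.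
    move=> /andP[u1 u2]; apply/eqP; rewrite -addr_eq0; apply/eqP.
    rewrite -[RHS](fg u t) => [|//|//]; last first.
      by apply: lt_le_trans u1; rewrite mulr_gt0.
    rewrite [RHS](bigID (fun i => c <= r i))/=; congr (_ + _).
      apply: eq_bigr => i ci; rewrite ifT//.
      by rewrite (le_trans u2)// ler_wpM2r// ltW.
    apply: eq_bigr => i ci; rewrite ifF//; apply/negbTE.
    rewrite -ltNge (lt_le_trans _ u1)// ltr_pM2r//.
    by rewrite ltNge; apply: contra ci => /gap.
  have ts : c' * t = s by rewrite /t; field; rewrite gt_eqF.
  have tq : c * t = s * (c / c') by rewrite /t; field; rewrite gt_eqF.
  have c't : c' * t <= c * t by rewrite ler_pM2r// ltW.
  by rewrite -tq -ts !cone ?lexx ?c't.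
move=> k s s0; apply/eqP/negPn/negP => fk.
(* Among the indices with a nonzero value at [s] take the one with the largest
   ratio: in the tail sum above that ratio it is the only nonzero term. *)
have [j fj jmax] := @arg_maxP _ _ _ k (fun i => f i s != 0) r fk.
have /eqP := tail0 (r j) (r0 j) s s0; rewrite (bigD1 j)//= big1 ?addr0.
  by apply/negP.
move=> i /andP[ji ij]; apply/eqP/negPn/negP => fi.
by move: ij; rewrite (rI i j) ?eqxx//; apply/le_anti; rewrite ji andbT; exact: jmax.
Qed.


Lemma cvg_inv_at_right0 (R : realType) (a : R) : 0 < a ->
  s^-1 / a @[s --> +oo] --> 0^'+.
Proof.
move=> a0; have u0 : s^-1 / a @[s --> +oo] --> 0.
  rewrite -(mul0r a^-1); apply: (cvgMr_tmp (f := fun s : R => s^-1)).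
  by apply/(gtr0_cvgV0 (f := id)) => //; exact: nbhs_pinfty_gt.
move=> A; rewrite /at_right /within/= => /u0 h.
have hA : \forall s \near +oo, 0 < s^-1 / a -> A (s^-1 / a) by exact: h.
have s_gt0 : \forall s \near +oo, (0 : R) < s by exact: nbhs_pinfty_gt.
apply: filterS2 s_gt0 hA => s s0; apply.
by rewrite divr_gt0 ?invr_gt0.
Qed.

(** On the positive half-line the ratios that govern which argument of the
    minimum is the smaller one are [a i / b i]; substituting [- s^-1] and
    [- t^-1] for [s] and [t] handles the negative half-line, with the ratios
    [b i / a i]. *)
Lemma min_sum_eq0 (R : realType) (I : finType) (a b : I -> R)
    (phi : I -> R -> R) :
  (forall i, 0 < a i) -> (forall i, 0 < b i) ->
  (forall i j, i != j -> a i / b i != a j / b j) ->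
  (forall i, phi i x @[x --> +oo] --> 0) ->
  (forall i, phi i x @[x --> 0^'+] --> phi i 0) ->
  (forall i, phi i (- x) @[x --> 0^'+] --> phi i 0) ->
  (forall s t, \sum_i phi i (Num.min (s / a i) (t / b i)) = 0) ->
  forall i x, phi i x = 0.
Proof.
move=> a0 b0 ab phioo phi0r phi0l sum0.
have rI : injective (fun i => a i / b i).
  by move=> j k rjk; apply/eqP/negPn/negP => /ab; rewrite rjk eqxx.
have rVI : injective (fun i => b i / a i).
  by move=> j k rjk; apply: rI; apply: invr_inj; rewrite !invf_div.
have pos i x : 0 < x -> phi i x = 0.
  move=> x0; rewrite -(mulfK (lt0r_neq0 (a0 i)) x).
  apply: (@threshold_sum_eq0 _ _ (fun i => a i / b i)
    (fun i s => phi i (s / a i)) (fun i t => phi i (t / b i))) => //.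
  - by move=> j; rewrite divr_gt0.
  - move=> j; have sa : s / a j @[s --> +oo] --> +oo.
      by apply: gt0_cvgMly; rewrite ?invr_gt0//; exact: cvg_id.
    exact: (cvg_comp _ _ sa (phioo j)).
  - move=> s t s0 t0; rewrite -[RHS](sum0 s t); apply: eq_bigr => j _.
    rewrite minEle ler_pdivrMr//.
    by rewrite (_ : t / b j * a j = a j / b j * t); [case: ifP|ring].
  - by rewrite mulr_gt0.
have at0 i : phi i 0 = 0.
  have /(cvg_unique _ (phi0r i)) : phi i x @[x --> 0^'+] --> 0; last by apply.
  apply: cvg_near_cst.
  by near=> x; exact: pos.
move=> i x; have [x_gt0|x_lt0|<-] := ltgtP 0 x; [exact: pos| |exact: at0].
rewrite (_ : x = - ((- (x * a i))^-1^-1 / a i)); last first.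
  by rewrite invrK mulNr opprK mulfK ?lt0r_neq0.
apply: (@threshold_sum_eq0 _ _ (fun i => b i / a i)
  (fun i s => phi i (- (s^-1 / a i))) (fun i t => phi i (- (t^-1 / b i)))) => //.
- by move=> j; rewrite divr_gt0.
- move=> j; rewrite -(at0 j).
  exact: (cvg_comp _ _ (cvg_inv_at_right0 (a0 j)) (phi0l j)).
- move=> s t s0 t0; rewrite -[RHS](sum0 (- s^-1) (- t^-1)).
  apply: eq_bigr => j _.
  rewrite minEle !mulNr lerN2 -!invfM lef_pV2 ?posrE ?mulr_gt0//.
  rewrite -ler_pdivlMr//.
  by rewrite (_ : t * b j / a j = b j / a j * t); [case: ifP|ring].
- by rewrite invr_gt0 oppr_gt0 nmulr_rlt0.
Unshelve. all: by end_near. Qed.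

Lemma cvg_ln (R : realType) (T : Type) (F : set_system T) (f : T -> R) (l : R) :
  Filter F -> 0 < l -> f x @[x --> F] --> l -> ln (f x) @[x --> F] --> ln l.
Proof. by move=> FF l0; apply: continuous_cvg; exact: continuous_ln. Qed.

Section real_random_variables.
Context d (T : measurableType d) (R : realType) (P : probability T R).
Implicit Type X : {RV P >-> R}.

Lemma cdfE X x : cdf X x = P [set w | X w <= x].
Proof. by rewrite /cdf /distribution /pushforward set_itvNyc. Qed.

Lemma fine_cdfK X x : (fine (cdf X x))%:E = cdf X x.
Proof. by rewrite fineK// fin_num_measure. Qed.

Lemma measurable_RV_preimage X (D : set R) : measurable D ->
  measurable [set w | D (X w)].
Proof.
by move=> mD; rewrite -[X in measurable X]setTI; exact: (measurable_funP X).
Qed.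

Lemma measurable_le X x : measurable [set w | X w <= x].
Proof.
by apply: (@measurable_RV_preimage X [set y | y <= x]); rewrite -set_itvNyc.
Qed.

(** The distribution function of [- X] is right continuous, and its complement
    [x |-> P (X < - x)] lies below [cdf X (- x)].  The latter is thus squeezed
    between a function that tends to [P (X < 0) = P (X <= 0)] and the constant
    [P (X <= 0)]. *)
Lemma cdf_left_cvg0 X : P [set w | X w = 0] = 0%E ->
  fine (cdf X (- x)) @[x --> 0^'+] --> fine (cdf X 0).
Proof.
move=> X0.
have mY : (fun w => - X w) \in mfun by apply: mem_set; exact: measurableT_comp.
pose Y : {RV P >-> R} := mfun_Sub mY.
have mlt x : measurable [set w | X w < x].
  by apply: (@measurable_RV_preimage X [set y | y < x]); rewrite -set_itvNyo.
have GE x : fine (cdf Y x) = 1 - fine (P [set w | X w < - x]).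
  apply: EFin_inj; rewrite fine_cdfK EFinB fineK ?fin_num_measure//.
  rewrite cdfE -probability_setC//; congr (P _); apply/seteqP.
  have YE w : (Y w <= x) = ~~ (X w < - x) by rewrite -leNgt lerNl.
  split=> w h; first by apply/negP; rewrite -YE.
  by suff : Y w <= x by []; rewrite YE; exact/negP.
have lt0 : P [set w | X w < 0] = cdf X 0.
  have m0 : measurable [set w | X w = 0].
    by apply: (@measurable_RV_preimage X [set 0]); exact: measurable_set1.
  rewrite -(measureU0 (mlt 0) m0 X0) cdfE; congr (P _); apply/seteqP; split=> w /=; rewrite le_eqVlt.
    by case=> [->|->]; rewrite ?eqxx ?orbT.
  by case/orP => [/eqP|]; [right|left].
have Gr : fine (cdf Y x) @[x --> 0^'+] --> fine (cdf Y 0).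
  by apply: fine_cvg; rewrite fine_cdfK; exact: cdf_right_continuous.
have F0 : 1 - fine (cdf Y 0) = fine (cdf X 0).
  by rewrite GE oppr0 lt0; ring.
apply: (squeeze_cvgr (f := fun x => 1 - fine (cdf Y x))
  (h := cst (fine (cdf X 0)))).
- near=> x; apply/andP; split; last first.
    by rewrite -lee_fin !fine_cdfK cdf_nondecreasing// oppr_le0.
  rewrite GE opprB addrC subrK -lee_fin fine_cdfK cdfE fineK; last first.
    by rewrite fin_num_measure//; exact: mlt.
  apply: le_measure; rewrite ?inE; [exact: mlt|exact: measurable_le|].
  by move=> w /= /ltW.
- by rewrite -F0; apply: cvgB => //; exact: cvg_cst.
- exact: cvg_cst.
Unshelve. all: by end_near. Qed.

Lemma max_comb_leP n (c : 'I_n.+1 -> R) (X : 'I_n.+1 -> {RV P >-> R}) w y :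
  (forall i, 0 < c i) ->
  max_comb c X w <= y <-> forall i, X i w <= y / c i.
Proof.
move=> c0; split=> [/bigmax_leP[_ h] i|h].
  by rewrite ler_pdivlMr// mulrC h.
by apply/bigmax_leP; split=> [|i _]; rewrite mulrC -ler_pdivlMr.
Qed.

Lemma prob_max_comb_le n (a b : 'I_n.+1 -> R) (X : 'I_n.+1 -> {RV P >-> R}) s t :
  (forall i, 0 < a i) -> (forall i, 0 < b i) ->
  pushforward P (fun w => (max_comb a X w, max_comb b X w))
    ([set y | y <= s] `*` [set y | y <= t]) =
  joint_cdf X (fun i => Num.min (s / a i) (t / b i)).
Proof.
move=> a0 b0; congr (P _); apply/seteqP; split=> w /=.
  move=> [/(max_comb_leP _ _ _ a0) ha /(max_comb_leP _ _ _ b0) hb] i.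
  by rewrite le_min ha hb.
move=> h; split; [apply/(max_comb_leP _ _ _ a0)|
  apply/(max_comb_leP _ _ _ b0)] => i;
  by have := h i; rewrite le_min => /andP[].
Qed.

(** Writing the product of the marginals as an exponential turns the comparison
    of two joint distribution functions into a linear equation. *)
Lemma max_independent_joint_cdfE n (X : 'I_n -> {RV P >-> R}) eta x :
  max_independent_with X eta -> (forall i x, (0 < cdf (X i) x)%E) ->
  joint_cdf X x = (expR (\sum_i ln (fine (cdf (X i) (x i)))) * eta x)%:E.
Proof.
case=> _ XE _ Xpos; rewrite XE expR_sum EFinM -prodEFin; congr (_ * _)%E.
apply: eq_bigr => i _; rewrite lnK ?fine_cdfK// posrE -lte_fin fine_cdfK.
exact: Xpos.
Qed.

End real_random_variables.

Theorem theorem5p3 (R : realType) (n : nat)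
  (d : measure_display) (T : measurableType d) (P : probability T R)
  (d' : measure_display) (T' : measurableType d') (P' : probability T' R)
  (X : 'I_n.+1 -> {RV P >-> R}) (X' : 'I_n.+1 -> {RV P' >-> R})
  (eta : ('I_n.+1 -> R) -> R) (a b : 'I_n.+1 -> R)
  (ha : forall i, 0 < a i) (hb : forall i, 0 < b i)
  (hab : forall i j, i != j -> a i / b i != a j / b j)
  (hX : max_independent_with X eta)
  (hXpos : forall i x, (0 < cdf (X i) x)%E)
  (hX0 : forall i, P [set w | X i w = 0] = 0%E)
  (hX' : max_independent_with X' eta)
  (hX'pos : forall i x, (0 < cdf (X' i) x)%E)
  (hX'0 : forall i, P' [set w | X' i w = 0] = 0%E)
  (hY : same_joint_distribution P (max_comb a X) (max_comb b X)
          P' (max_comb a X') (max_comb b X')) :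
  forall i, cdf (X' i) = cdf (X i).
Proof.
pose phi i x := ln (fine (cdf (X i) x)) - ln (fine (cdf (X' i) x)).
have Fpos i x : 0 < fine (cdf (X i) x) by rewrite -lte_fin fine_cdfK.
have F'pos i x : 0 < fine (cdf (X' i) x) by rewrite -lte_fin fine_cdfK.
have phi_eq0 i x : phi i x = 0 -> cdf (X' i) x = cdf (X i) x.
  move=> /eqP; rewrite subr_eq0 => /eqP /ln_inj h.
  by rewrite -fine_cdfK -[RHS]fine_cdfK h ?posrE.
have sum0 s t : \sum_i phi i (Num.min (s / a i) (t / b i)) = 0.
  set z := fun i => Num.min (s / a i) (t / b i).
  have eta0 : eta z != 0 by case: hX => /(_ z)/andP[/lt0r_neq0].
  have : joint_cdf X z = joint_cdf X' z.
    rewrite -!prob_max_comb_le//; apply: hY; apply: measurableX;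
    by rewrite -set_itvNyc.
  rewrite (max_independent_joint_cdfE z hX hXpos).
  rewrite (max_independent_joint_cdfE z hX' hX'pos) => -[] /(mulIf eta0)/expR_inj h.
  by rewrite /phi sumrB h subrr.
have phioo i : phi i x @[x --> +oo] --> 0.
  rewrite -(subrr (ln (1 : R))).
  by apply: cvgB; apply: cvg_ln => //; apply: fine_cvg; exact: cvg_cdfy1.
have F0 i : fine (cdf (X i) x) @[x --> 0^'+] --> fine (cdf (X i) 0).
  by apply: fine_cvg; rewrite fine_cdfK; exact: cdf_right_continuous.
have F'0 i : fine (cdf (X' i) x) @[x --> 0^'+] --> fine (cdf (X' i) 0).
  by apply: fine_cvg; rewrite fine_cdfK; exact: cdf_right_continuous.
have phi0r i : phi i x @[x --> 0^'+] --> phi i 0.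
  by apply: cvgB; apply: cvg_ln.
have phi0l i : phi i (- x) @[x --> 0^'+] --> phi i 0.
  by apply: cvgB; apply: cvg_ln => //; exact: cdf_left_cvg0.
move=> i; apply/funext => x; apply: phi_eq0.
exact: (@min_sum_eq0 _ _ a b).
Qed.
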